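(* Let $\mathfrak{F}=(X,R)$ be a rooted frame, $\mathfrak{G}=(Y,S)$ a rooted image-finite frame, $y\in Y$ and $k\in\mathbb{Z}^+$. Suppose $X=R_\sharp^{k-1}[x]$ for all $x\in X$. Then there is a surjective t-morphism from $\mathfrak{F}$ onto $\mathfrak{G}$ if and only if $\mathfrak{F}\not\models\neg\mathcal{J}^k(\mathfrak{G},y)$.
   Context: Tense formulas use $\Box$, $\Diamond=\neg\Box\neg$ and a past possibility operator written here $\mathsf{P}$ ($\mathsf{P}\phi$ true at $x$ iff $\phi$ true at some $z$ with $Rzx$). Frames here are arbitrary Kripke frames. For a frame $(X,R)$ and $x\in X$: $R_\sharp^0[x]=\{x\}$, $R_\sharp^{j+1}[x]=R_\sharp^j[x]\cup R[R_\sharp^j[x]]\cup R^{-1}[R_\sharp^j[x]]$; the frame is rooted if $X=\bigcup_jR_\sharp^j[x]$ for some $x$, and image-finite if $R_\sharp^1[x]$ is finite for every $x$. Let $\Delta^0\phi=\phi$, $\Delta^{j+1}\phi=\Delta^j\phi\vee\Diamond\Delta^j\phi\vee\mathsf{P}\Delta^j\phi$ and $\nabla^j\phi=\neg\Delta^j\neg\phi$. For an image-finite $\mathfrak{G}=(Y,S)$, $y\in Y$ and $k\in\mathbb{Z}^+$, enumerate $S_\sharp^k[y]$ as $\langle y_i:i<n\rangle$ with $y_0=y$; the generalized Jankov formula $\mathcal{J}^k(\mathfrak{G},y)$ is the conjunction of: $p_0\wedge\nabla^k(p_0\vee\dots\vee p_{n-1})$; $\nabla^k(p_i\to\neg p_j)$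 for $i\neq j$; $\nabla^{k-1}((p_i\to\Diamond p_j)\wedge(p_j\to\mathsf{P}p_i))$ whenever $Sy_iy_j$; $\nabla^{k-1}((p_i\to\neg\Diamond p_j)\wedge(p_j\to\neg\mathsf{P}p_i))$ whenever not $Sy_iy_j$. A t-morphism $f:(X,R)\to(Y,S)$ is a map with $f[R[x]]=S[f(x)]$ and $f[R^{-1}[x]]=S^{-1}[f(x)]$ for all $x$. *)

(* Defs.v *)
From mathcomp Require Import all_boot.
From mathcomp Require Import mathcomp_extra boolp classical_sets functions cardinality.

Set Implicit Arguments.
Unset Strict Implicit.
Unset Printing Implicit Defensive.

Local Open Scope classical_set_scope.

Record frame := Frame {
  point :> Type;
  acc : point -> point -> Prop
}.

Section Frames.
Variable F : frame.
Implicit Types (x z : F) (A : set F) (j : nat).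

Definition fut x : set F := [set z | acc x z].
Definition past x : set F := [set z | acc z x].

Fixpoint sharp j x : set F :=
  if j is j'.+1 then
    sharp j' x `|` \bigcup_(z in sharp j' x) fut z
               `|` \bigcup_(z in sharp j' x) past z
  else [set x].

Definition rooted : Prop := exists x, [set: F] = \bigcup_j sharp j x.

Definition image_finite : Prop := forall x, finite_set (sharp 1 x).
End Frames.

Definition t_morphism (F G : frame) (f : F -> G) : Prop :=
  forall x, f @` fut x = fut (f x) /\ f @` past x = past (f x).

Inductive formula :=
| Var of nat
| Bot
| Imp of formula & formula
| Box of formula
| Past of formula.  (* existential past modality *)

Definition Neg phi := Imp phi Bot.
Definition Top := Neg Bot.
Definition Or phi psi := Imp (Neg phi) psi.
Definition And phi psi := Neg (Imp phi (Neg psi)).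
Definition Dia phi := Neg (Box (Neg phi)).

Fixpoint Delta j phi :=
  if j is j'.+1 then
    Or (Or (Delta j' phi) (Dia (Delta j' phi))) (Past (Delta j' phi))
  else phi.

Definition Nabla j phi := Neg (Delta j (Neg phi)).

Fixpoint sat (F : frame) (V : nat -> set F) (x : F) phi : Prop :=
  match phi with
  | Var p => V p x
  | Bot => False
  | Imp a b => sat V x a -> sat V x b
  | Box a => forall z, acc x z -> sat V z a
  | Past a => exists2 z, acc z x & sat V z a
  end.

Definition valid (F : frame) phi : Prop :=
  forall (V : nat -> set F) (x : F), sat V x phi.

(* [e] lists S_sharp^k[y] without repetition, starting with y; there are n.+1
   entries since that set always contains y. *)
Definition enumerates (G : frame) k (y : G) n (e : 'I_n.+1 -> G) : Prop :=
  [/\ injective e, range e = sharp k y & e ord0 = y].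

Lemma finite_sharp (G : frame) : image_finite G ->
  forall k (y : G), finite_set (sharp k y).
Proof.
move=> fin; elim=> [|k IH] y; first exact: finite_set1.
apply: (@sub_finite_set _ _ (\bigcup_(z in sharp k y) sharp 1 z)); last first.
  by apply: bigcup_finite => // z _; exact: fin.
move=> u /= [[yu|[z yz zu]]|[z yz zu]].
- by exists u => //; left; left.
- by exists z => //; left; right; exists z.
- by exists z => //; right; exists z.
Qed.

Lemma enumerates_exists (G : frame) k (y : G) : image_finite G ->
  exists n (e : 'I_n.+1 -> G), enumerates k y e.
Proof.
move=> /finite_sharp /(_ k y) fin.
have ky : sharp k y y by elim: (k) => //= j IH; left; left.
have /(@finite_seqP {classic G})[s sE] : finite_set (sharp k y `\ y).
  exact: sub_finite_set fin.
have sP (z : {classic G}) : (z \in s) <-> (sharp k y z /\ z <> y).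
  have -> : (z \in s) = ([set` s] z) :> Prop by [].
  by rewrite -sE.
pose r : seq {classic G} := (y : {classic G}) :: undup s.
have ur : uniq r.
  by rewrite /= undup_uniq andbT mem_undup; apply/negP => /sP[].
exists (size (undup s)), (fun i => nth (y : {classic G}) r i); split => //.
- move=> i j ij; apply: val_inj.
  by apply: (uniqP (y : {classic G}) ur) => //; rewrite inE /= ltn_ord.
- apply/seteqP; split=> [z [i _ <-]|z kz].
    have : nth (y : {classic G}) r i \in r by exact: mem_nth.
    by rewrite in_cons mem_undup => /orP[/eqP ->//|/sP[]].
  have zr : (z : {classic G}) \in r.
    rewrite in_cons mem_undup; have [//|zy] /= := eqVneq (z : {classic G}) y.
    by apply/sP; split=> //; apply/eqP.
  have iz : index (z : {classic G}) r < (size (undup s)).+1.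
    by move: zr; rewrite -index_mem.
  by exists (Ordinal iz) => //=; exact: (nth_index (y : {classic G}) zr).
Qed.

(* J^k(G, y), where y and the set S_sharp^k[y] enter only through its
   enumeration [e]; the propositional variable p_i is [Var i]. *)
Definition jankov (G : frame) k n (e : 'I_n.+1 -> G) : formula :=
  And (And (Var 0) (Nabla k (\big[Or/Bot]_(i < n.+1) Var i)))
  (And (\big[And/Top]_(i < n.+1) \big[And/Top]_(j < n.+1 | i != j)
          Nabla k (Imp (Var i) (Neg (Var j))))
  (And (\big[And/Top]_(i < n.+1)
        \big[And/Top]_(j < n.+1 | `[< acc (e i) (e j) >])
          Nabla k.-1 (And (Imp (Var i) (Dia (Var j)))
                          (Imp (Var j) (Past (Var i)))))
       (\big[And/Top]_(i < n.+1)
        \big[And/Top]_(j < n.+1 | ~~ `[< acc (e i) (e j) >])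
          Nabla k.-1 (And (Imp (Var i) (Neg (Dia (Var j))))
                          (Imp (Var j) (Neg (Past (Var i)))))))).

(* Main.v *)
Require Import Defs.
From mathcomp Require Import all_boot.
From mathcomp Require Import mathcomp_extra boolp classical_sets functions cardinality.
Local Open Scope classical_set_scope.

(** A point satisfying [jankov k e] induces a map sending [z] to the unique
    [e i] with [p_i] true at [z].  The reach hypothesis makes the [Nabla]
    clauses global on the source frame, so the negative clauses say that the map
    preserves the relation.  Its image therefore lies in the ball of radius
    [k.-1] around [y], all of whose neighbours are still enumerated by [e], so
    the positive clauses give the back conditions.  Conversely, a surjective
    t-morphism [f] yields the valuation [p_i := f @^-1` [set e i]]. *)

(** * Balls as endpoints of bounded zigzag paths *)

Definition adj (F : frame) (x z : F) : Prop := acc x z \/ acc z x.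

Lemma adjC {F : frame} (x z : F) : adj F x z -> adj F z x.
Proof. by case; [right|left]. Qed.

Lemma sharpS (F : frame) j (x z : F) :
  sharp j.+1 x z <-> sharp j x z \/ exists2 w, sharp j x w & adj F w z.
Proof.
split=> [[[xz|[w xw wz]]|[w xw zw]]|[xz|[w xw [wz|zw]]]].
- by left.
- by right; exists w => //; left.
- by right; exists w => //; right.
- by left; left.
- by left; right; exists w.
- by right; exists w.
Qed.

(** [sharp] extends a path at its far end, whereas unfolding [Delta] consumes its first step; this
    recursion at the near end reconciles the two. *)
Lemma sharpSl (F : frame) j (x z : F) :
  sharp j.+1 x z <-> sharp j x z \/ exists2 w, adj F x w & sharp j w z.
Proof.
elim: j z => [|j IH] z.
  rewrite sharpS; split=> -[xz|[w]]; [by left|by move=> ->; right; exists z|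
    by left|by move=> xw ->; right; exists x].
rewrite sharpS; split=> [[xz|[w /IH[xw|[v xv vw]] wz]]|[xz|[v xv]]].
- by left.
- by left; apply/sharpS; right; exists w.
- by right; exists v => //; apply/sharpS; right; exists w.
- by left.
- case/sharpS=> [vz|[w vw wz]]; first by left; apply/IH; right; exists v.
  by right; exists w => //; apply/IH; right; exists v.
Qed.

Lemma sharp_predn (F : frame) k (x : F) : sharp k.-1 x `<=` sharp k x.
Proof. by case: k => [//|k] z xz; apply/sharpS; left. Qed.

Lemma sharp_closed {F : frame} (A : set F) {j x z} :
  (forall u v, adj F u v -> A u -> A v) -> sharp j x z -> A x -> A z.
Proof.
move=> adjA; elim: j z => [z ->//|j IH z] /sharpS[/IH//|[w /IH xw /adjA wz]].
by move=> /xw /wz.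
Qed.

Lemma rooted_closedT (F : frame) (A : set F) (x : F) : rooted F ->
  (forall u v, adj F u v -> A u -> A v) -> A x -> A = setT.
Proof.
move=> [r rootr] adjA Ax; apply/seteqP; split=> // z _.
have reach u : exists j, sharp j r u.
  by have : [set: F] u by []; rewrite rootr => -[j _ ru]; exists j.
(* As [adj] is symmetric, the complement of [A] is closed too. A root outside [A] would thus force
   [x] outside [A]. *)
have adjNA u v : adj F u v -> (~` A) u -> (~` A) v.
  by move=> /adjC /adjA vu nAu /vu.
have Ar : A r.
  apply: contrapT => nAr; have [j rx] := reach x.
  exact: (sharp_closed (~` A) adjNA rx nAr).
by have [j rz] := reach z; apply: (sharp_closed A adjA rz).
Qed.

(** * Relation-preserving maps and t-morphisms *)

Section Morphism.
Variables (F G : frame) (f : F -> G).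

(** Only preservation of the relation is assumed, so that this applies to the map read off a
    valuation before its back conditions are known. *)
Lemma sharp_homo j x z : (forall u v, acc u v -> acc (f u) (f v)) ->
  sharp j x z -> sharp j (f x) (f z).
Proof.
move=> facc; elim: j z => [z ->//|j IH z] /sharpS[xz|[w xw wz]]; apply/sharpS.
  by left; apply: IH.
by right; exists (f w); [apply: IH|case: wz => /facc; [left|right]].
Qed.

Hypothesis tf : t_morphism f.

Lemma t_morphism_acc u v : acc u v -> acc (f u) (f v).
Proof.
by move=> uv; have [E _] := tf u; have : fut (f u) (f v) by rewrite -E; exists v.
Qed.

Lemma t_morphism_fut x u : acc (f x) u -> exists2 z, acc x z & f z = u.
Proof. by have [E _] := tf x; move=> xu; have : fut (f x) u by []; rewrite -E. Qed.

Lemma t_morphism_past x u : acc u (f x) -> exists2 z, acc z x & f z = u.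
Proof. by have [_ E] := tf x; move=> ux; have : past (f x) u by []; rewrite -E. Qed.

(** The back conditions make the range closed under [adj]; [x] supplies a point of it. *)
Lemma t_morphism_surj (x : F) : rooted G -> range f = setT.
Proof.
move=> rootG; apply: (@rooted_closedT _ _ (f x)) => //.
by move=> _ v /[swap] -[w _ <-] [/t_morphism_fut|/t_morphism_past]
  [z _ <-]; exists z.
Qed.
End Morphism.

(** * Truth conditions of the derived connectives and of the Jankov formula *)

Section Sat.
Variables (F : frame) (V : nat -> set F).
Implicit Types (x z : F) (phi psi : formula).

Lemma sat_Or x phi psi : sat V x (Or phi psi) <-> sat V x phi \/ sat V x psi.
Proof.
split=> /= [h|[xphi /(_ xphi)//|//]].
by have [xphi|nphi] := pselect (sat V x phi); [left|right; apply: h].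
Qed.

Lemma sat_And x phi psi : sat V x (And phi psi) <-> sat V x phi /\ sat V x psi.
Proof.
split=> /= [h|[a b] /(_ a b)//].
by split; apply: contrapT => n; apply: h => // a b; apply: n.
Qed.

Lemma sat_Dia x phi : sat V x (Dia phi) <-> exists2 z, acc x z & sat V z phi.
Proof.
split=> /= [h|[z xz zphi] /(_ z xz)//].
by apply: contrapT => n; apply: h => z xz zphi; apply: n; exists z.
Qed.

Lemma sat_bigOr (I : finType) (P : I -> formula) x :
  sat V x (\big[Or/Bot]_i P i) <-> exists i, sat V x (P i).
Proof.
suff h s : sat V x (\big[Or/Bot]_(i <- s) P i) <->
    exists2 i, i \in s & sat V x (P i).
  by rewrite h; split=> [[i _ ?]|[i ?]]; exists i; rewrite ?mem_index_enum.
elim: s => [|a s IH]; first by rewrite big_nil; split=> // -[].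
rewrite big_cons sat_Or IH; split=> [[xa|[i si xi]]|[i]].
- by exists a; rewrite ?mem_head.
- by exists i; rewrite // in_cons si orbT.
- by rewrite in_cons => /predU1P[->|si] xi; [left|right; exists i].
Qed.

Lemma sat_bigAnd (I : finType) (C : pred I) (P : I -> formula) x :
  sat V x (\big[And/Top]_(i | C i) P i) <-> forall i, C i -> sat V x (P i).
Proof.
suff h s : sat V x (\big[And/Top]_(i <- s | C i) P i) <->
    forall i, i \in s -> C i -> sat V x (P i).
  by rewrite h; split=> H i *; apply: H; rewrite ?mem_index_enum.
elim: s => [|a s IH]; first by rewrite big_nil; split=> //= _ [].
rewrite big_cons; case: ifPn => Ca.
  rewrite sat_And IH; split=> [[xa xs] i|H].
    by rewrite in_cons => /predU1P[->//|]; apply: xs.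
  by split=> [|i si]; apply: H; rewrite ?mem_head // in_cons si orbT.
rewrite IH; split=> H i si.
  by move: si; rewrite in_cons => /predU1P[->|/H//]; rewrite (negPf Ca).
by apply: H; rewrite in_cons si orbT.
Qed.

Lemma sat_Delta j phi x :
  sat V x (Delta j phi) <-> exists2 z, sharp j x z & sat V z phi.
Proof.
elim: j x => [|j IH] x.
  by split=> [xphi|[z -> //]]; exists x.
rewrite [Delta _ _]/= sat_Or sat_Or sat_Dia IH [sat V x (Past _)]/=.
split=> [[[[z xz ?]|[w xw /IH[z wz ?]]]|[w wx /IH[z wz ?]]]|[z]].
- by exists z => //; apply/sharpSl; left.
- by exists z => //; apply/sharpSl; right; exists w => //; left.
- by exists z => //; apply/sharpSl; right; exists w => //; right.
- case/sharpSl=> [xz|[w [xw|wx] wz]] zphi.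
  + by left; left; exists z.
  + by left; right; exists w => //; apply/IH; exists z.
  + by right; exists w => //; apply/IH; exists z.
Qed.

Lemma sat_Nabla j phi x :
  sat V x (Nabla j phi) <-> forall z, sharp j x z -> sat V z phi.
Proof.
rewrite [sat _ _ _]/=; split=> [h z xz|h /sat_Delta[z /h ? nz]]; last exact: nz.
by apply: contrapT => nz; apply: h; apply/sat_Delta; exists z.
Qed.

(** Reading [V i] as the fibre over [e i], the clauses say: base point, covering, disjointness, back
    conditions, preservation of the relation. *)
Lemma sat_jankov (G : frame) k n (e : 'I_n.+1 -> G) x :
  sat V x (jankov k e) <->
  [/\ V 0 x,
      forall z, sharp k x z -> exists i : 'I_n.+1, V i z,
      forall (i j : 'I_n.+1) z, i != j -> sharp k x z -> V i z -> ~ V j z,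
      forall (i j : 'I_n.+1) z, acc (e i) (e j) -> sharp k.-1 x z ->
        (V i z -> exists2 w, acc z w & V j w) /\
        (V j z -> exists2 w, acc w z & V i w)
    & forall (i j : 'I_n.+1) z, ~ acc (e i) (e j) -> sharp k.-1 x z ->
        (V i z -> ~ exists2 w, acc z w & V j w) /\
        (V j z -> ~ exists2 w, acc w z & V i w)].
Proof.
rewrite /jankov !sat_And sat_Nabla !sat_bigAnd.
split=> [[[V0 cov] [disj [pos neg]]]|[V0 cov disj pos neg]].
  split=> //.
  - by move=> z /cov /sat_bigOr.
  - move=> i j z ij xz; have /sat_bigAnd/(_ j ij)/sat_Nabla := disj i isT.
    exact.
  - move=> i j z /asboolP ij xz.
    have /sat_bigAnd/(_ j ij)/sat_Nabla/(_ z xz)/sat_And[a b] := pos i isT.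
    by split=> [zi|/b//]; apply/(sat_Dia z (Var j))/a.
  - move=> i j z /asboolPn ij xz.
    have /sat_bigAnd/(_ j ij)/sat_Nabla/(_ z xz)/sat_And[a b] := neg i isT.
    by split=> [zi ?|/b//]; apply: (a zi); apply/(sat_Dia z (Var j)).
split; first by split=> // z xz; apply/sat_bigOr; apply: cov.
split.
  move=> i _; apply/sat_bigAnd => j ij; apply/sat_Nabla => z xz.
  exact: disj.
split=> i _; apply/sat_bigAnd => j.
  move=> /asboolP ij; apply/sat_Nabla => z xz; apply/sat_And.
  by have [a b] := pos i j z ij xz; split=> // zi; apply/(sat_Dia z (Var j))/a.
move=> /asboolPn ij; apply/sat_Nabla => z xz; apply/sat_And.
by have [a b] := neg i j z ij xz; split=> [zi /(sat_Dia z (Var j))|/b//]; exact: a.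
Qed.
End Sat.

Theorem theorem3p12 (F G : frame) (y : G) (k : nat) :
  rooted F -> rooted G -> image_finite G -> 0 < k ->
  (forall x : F, [set: F] = sharp k.-1 x) ->
  forall (n : nat) (e : 'I_n.+1 -> G), enumerates k y e ->
  (exists f : F -> G, range f = [set: G] /\ t_morphism f) <->
  ~ valid F (Neg (jankov k e)).
Proof.
move=> _ rootG _ k0 reach n e [injE rangeE e0].
have reach1 (x z : F) : sharp k.-1 x z by rewrite -reach.
have reachk (x z : F) : sharp k x z by apply: sharp_predn.
split=> [[f [fsurj tf]]|].
  have [x _ fx] : range f y by rewrite fsurj.
  (* Variables range over all naturals; [inord] sends any [m] above [n] to [ord0], and no such
     variable occurs in the formula. *)
  pose V m := f @^-1` [set e (inord m)].
  have VE (i : 'I_n.+1) z : V i z <-> f z = e i by rewrite /V /= inord_val.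
  move=> /(_ V x); apply; apply/sat_jankov; split.
  - by apply/(VE ord0); rewrite e0.
  - move=> z xz; have : range e (f z).
      by rewrite rangeE -fx; apply: sharp_homo xz; exact: t_morphism_acc tf.
    by move=> [i _ ei]; exists i; apply/VE.
  - by move=> i j z /eqP ij _ /VE fi /VE; rewrite fi => /injE.
  (* One end of the arrow is now [f z], so a back condition of [f] lifts it to [z]. *)
  - move=> i j z ij _; split=> /VE fz; rewrite -fz in ij.
      by have [w zw wj] := t_morphism_fut _ _ _ tf _ _ ij; exists w => //; apply/VE.
    by have [w zw wj] := t_morphism_past _ _ _ tf _ _ ij; exists w => //; apply/VE.
  - move=> i j z ij _; split=> /VE fz [w zw /VE fw]; apply: ij;
      by rewrite -fz -fw; apply: t_morphism_acc.
move=> /existsNP[V] /existsNP[x] /contrapT /sat_jankov[V0 cov disj pos neg].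
(* Covering lets an index be chosen at each point; disjointness makes it the only one. *)
have [g Vg] := choice (fun z => cov z (reachk x z)).
have gP (i : 'I_n.+1) z : V i z -> g z = i.
  by move=> Viz; apply: contrapT => /eqP gi; apply: (disj _ _ z gi).
pose f := e \o g.
have facc u v : acc u v -> acc (f u) (f v).
  move=> uv; apply: contrapT => nuv.
  (* If [f u] did not see [f v], this clause would deny [u] any successor in [V (g v)], yet [v] is
     one. *)
  have [h _] := neg _ _ u nuv (reach1 _ _).
  by apply: (h (Vg u)); exists v.
have fx : f x = y by rewrite /f /= (gP ord0).
have nbr z u : adj G (f z) u -> exists j, e j = u.
  move=> zu; suff : range e u by case=> j _; exists j.
  (* Positivity of [k] leaves room for one step beyond radius [k.-1], where [f z] lies. *)
  rewrite rangeE -(prednK k0); apply/sharpS; right; exists (f z) => //.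
  by rewrite -fx; apply: sharp_homo.
exists f; suff tf : t_morphism f by split=> //; apply: t_morphism_surj.
(* [facc] settles both forward inclusions. For the converses, the positive clause yields [w] in
   [V j], and [gP] turns this into [f w = e j]. *)
move=> z; split; apply/seteqP; split=> [_ [w zw <-]|u zu]; try exact: facc.
  have [j ej] := nbr z u (or_introl zu); rewrite -ej /= in zu *.
  have [/(_ (Vg z))[w zw /gP wj] _] := pos _ _ z zu (reach1 x z).
  by exists w; rewrite // /f /= wj.
have [j ej] := nbr z u (or_intror zu); rewrite -ej /= in zu *.
have [_ /(_ (Vg z))[w zw /gP wj]] := pos _ _ z zu (reach1 x z).
by exists w; rewrite // /f /= wj.
Qed.
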